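(* Let $X$ be a diffeological space. The identity map $\mathrm{id}:\mathfrak{P}_{u}(X)\rightarrow \mathfrak{P}_{w}(X)$ is smooth. In other words, the union power set diffeology on the power set of $X$ is finer than (i.e. contained in) the weak power set diffeology.
   Context: A parametrization in a set $X$ is a map $P:U\to X$ with $U$ an open subset of some $\mathbb{R}^n$. A diffeology on $X$ is a set of parametrizations in $X$ (called plots) that contains all constant parametrizations, is local (a parametrization that is a plot in a neighborhood of each point of its domain is a plot), and is stable under precomposition with smooth maps between open subsets of Euclidean spaces. A map $f$ between diffeological spaces is smooth if $f\circ P$ is a plot for every plot $P$. A diffeology $\mathcal{D}$ is finer than $\mathcal{D}'$ if $\mathcal{D}\subset\mathcal{D}'$. $\mathfrak{P}(X)$ is the set of all subsets of $X$. Weak power set diffeology: $P:U\to\mathfrak{P}(X)$ is a plot of $\mathfrak{P}_w(X)$ iff for every $r_0\in U$ with $P(r_0)\neq\emptyset$ there exist an open neighborhood $V\subset U$ of $r_0$ and a plot $\sigma:V\to X$ with $\sigma(r)\in P(r)$ for every $r\in V$. Union power set diffeology: $P:U\to\mathfrak{P}(X)$ is a plot of $\mathfrak{P}_u(X)$ iff there is a family of parametrizations $P_i:U_i\to\mathfrak{P}(X)$ ($i\in J$, $U_i$ open in the same Euclidean space, $U=\bigcup_i U_i$), each of which is either the constant map with value $\emptyset$ or of the form $r\mapsto\{p_i(r)\}$ for a plot $p_i:U_i\to X$, such that $P(r)=\bigcup\{P_i(r)\mid i\in J,\ r\in U_i\}$ for all $r\in U$. *)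

(* Defs.v *)
From HB Require Import structures.
From mathcomp Require Import all_boot all_order all_algebra.
From mathcomp Require Import all_classical all_reals all_analysis.

Set Implicit Arguments.
Unset Strict Implicit.
Unset Printing Implicit Defensive.

Import Order.TTheory GRing.Theory Num.Theory.
Import numFieldNormedType.Exports.
Local Open Scope classical_set_scope.
Local Open Scope ring_scope.

(* In finite dimension, f is C^(k+1) on an open set iff it is differentiable
   there and all its directional derivatives are C^k.  The values of f outside
   the open set U are irrelevant. *)
Fixpoint Ck_on (R : realType) (m n : nat) (k : nat) (U : set 'rV[R]_m)
    (f : 'rV[R]_m -> 'rV[R]_n) : Prop :=
  match k with
  | 0 => {in U, continuous f}
  | k'.+1 => {in U, forall x, differentiable f x} /\
             forall v : 'rV[R]_m, Ck_on k' U (fun x => 'D_v f x)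
  end.

Definition smooth_on (R : realType) (m n : nat) (U : set 'rV[R]_m)
    (f : 'rV[R]_m -> 'rV[R]_n) : Prop :=
  forall k, Ck_on k U f.

(* The sets U and V are used as the types of their elements; f is an arbitrary
   extension of F to the whole space, needed to speak of derivatives. *)
Definition smooth_between (R : realType) (m n : nat) (V : set 'rV[R]_m)
    (U : set 'rV[R]_n) (F : V -> U) : Prop :=
  exists2 f : 'rV[R]_m -> 'rV[R]_n,
    smooth_on V f & forall v : V, val (F v) = f (val v).

Record parametrization (R : realType) (n : nat) (X : Type) := Param {
  pdom : set 'rV[R]_n;
  pdom_open : open pdom;
  pmap :> pdom -> X
}.
Arguments pdom_open {R n X} p : rename.

Definition const_param (R : realType) (n : nat) (X : Type)
    (U : set 'rV[R]_n) (oU : open U) (x : X) : parametrization R n X :=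
  Param oU (fun=> x).

Definition precomp (R : realType) (m n : nat) (X : Type)
    (P : parametrization R n X) (V : set 'rV[R]_m) (oV : open V)
    (F : V -> pdom P) : parametrization R m X :=
  Param oV (P \o F).

Definition restrict (R : realType) (n : nat) (X : Type)
    (P : parametrization R n X) (V : set 'rV[R]_n) (oV : open V)
    (VP : V `<=` pdom P) : parametrization R n X :=
  Param oV (P \o subfun VP).

Definition postcomp (R : realType) (n : nat) (X Y : Type) (f : X -> Y)
    (P : parametrization R n X) : parametrization R n Y :=
  Param (pdom_open P) (f \o P).

Record diffeology (R : realType) (X : Type) := Diffeology {
  plot : forall n : nat, set (parametrization R n X);
  plot_const : forall (n : nat) (U : set 'rV[R]_n) (oU : open U) (x : X),
    plot (const_param oU x);
  plot_local : forall (n : nat) (P : parametrization R n X),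
    (forall r : pdom P, exists (V : set 'rV[R]_n) (oV : open V)
       (VP : V `<=` pdom P), V (val r) /\ plot (restrict oV VP)) ->
    plot P;
  plot_precomp : forall (m n : nat) (P : parametrization R n X)
    (V : set 'rV[R]_m) (oV : open V) (F : V -> pdom P),
    smooth_between F -> plot P -> plot (precomp oV F)
}.

Definition finer (R : realType) (X : Type) (D D' : diffeology R X) : Prop :=
  forall n : nat, @plot R X D n `<=` @plot R X D' n.

Record diffeologicalSpace (R : realType) := DiffeologicalSpace {
  carrier :> Type;
  diffeo : diffeology R carrier
}.

Definition is_plot (R : realType) (X : diffeologicalSpace R) (n : nat)
    (P : parametrization R n X) : Prop :=
  plot (diffeo X) P.

Definition smooth (R : realType) (X Y : diffeologicalSpace R) (f : X -> Y) :
    Prop :=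
  forall (n : nat) (P : parametrization R n X),
    is_plot P -> is_plot (postcomp f P).

Definition weak_plot (R : realType) (X : diffeologicalSpace R) (n : nat)
    (P : parametrization R n (set X)) : Prop :=
  forall r0 : pdom P, P r0 <> set0 ->
  exists (V : set 'rV[R]_n) (oV : open V) (VP : V `<=` pdom P) (sigma : V -> X),
    [/\ V (val r0), is_plot (Param oV sigma)
      & forall r : V, P (subfun VP r) (sigma r)].

Definition empty_or_point_plot (R : realType) (X : diffeologicalSpace R)
    (n : nat) (Q : parametrization R n (set X)) : Prop :=
  (forall r : pdom Q, Q r = set0) \/
  (exists2 p : pdom Q -> X,
     is_plot (Param (pdom_open Q) p) & forall r : pdom Q, Q r = [set p r]).

(* The inner union has at most one term: it is Pi i (val r) if val r lies in
   the domain of Pi i, and is empty otherwise. *)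
Definition union_plot (R : realType) (X : diffeologicalSpace R) (n : nat)
    (P : parametrization R n (set X)) : Prop :=
  exists (J : Type) (Pi : J -> parametrization R n (set X)),
    [/\ forall i, empty_or_point_plot (Pi i),
        pdom P = \bigcup_i pdom (Pi i)
      & forall r : pdom P,
          P r = \bigcup_i \bigcup_(s in [set s : pdom (Pi i) | val s = val r])
                  Pi i s].

Section Diffeologies.
Variables (R : realType) (X : diffeologicalSpace R).

Lemma Ck_onS m n k (U V : set 'rV[R]_m) (f : 'rV[R]_m -> 'rV[R]_n) :
  V `<=` U -> Ck_on k U f -> Ck_on k V f.
Proof.
move=> VU; have VU' x : x \in V -> x \in U by rewrite !inE; exact: VU.
elim: k f => [|k IH] f /=; first by move=> h x /VU'; exact: h.
by case=> h1 h2; split=> [x /VU'|v]; [exact: h1|exact/IH/h2].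
Qed.

Lemma set_typeP T (A : set T) (a : A) : A (val a).
Proof. exact: set_mem (valP a). Qed.

Lemma val_subfun T (A B : set T) (AB : A `<=` B) (a : A) :
  val (subfun AB a) = val a.
Proof. by []. Qed.

Lemma open_preim m n (V : set 'rV[R]_m) (U W : set 'rV[R]_n) (F : V -> U) :
  open V -> open W -> smooth_between F ->
  open [set x | exists2 v : V, val v = x & W (val (F v))].
Proof.
move=> oV oW [f sf Ff].
have -> : [set x | exists2 v : V, val v = x & W (val (F v))] = V `&` f @^-1` W.
  apply/seteqP; split=> x /=.
    by case=> v <- Wv; split; [exact: set_typeP|rewrite -Ff].
  case=> Vx Wx; exists (exist _ x (mem_set Vx)) => //.
  by rewrite Ff.
rewrite openE => x [Vx Wx]; apply: filterI.
  exact: open_nbhs_nbhs.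
apply: (sf 0%N x (mem_set Vx)).
exact: open_nbhs_nbhs.
Qed.

Lemma preim_lift m n (V : set 'rV[R]_m) (U W : set 'rV[R]_n) (F : V -> U) :
  smooth_between F ->
  let W' := [set x | exists2 v : V, val v = x & W (val (F v))] in
  exists2 G : W' -> W, smooth_between G &
    forall (w : W') (v : V), val w = val v -> val (G w) = val (F v).
Proof.
move=> [f sf Ff] W'.
have W'V : W' `<=` V by move=> x [v <- _]; exact: set_typeP.
have W'W (w : W') : f (val w) \in W.
  by have [v vw Wv] := set_typeP w; rewrite inE -vw -Ff.
exists (fun w => exist _ (f (val w)) (W'W w)).
  by exists f => // k; exact: Ck_onS W'V (sf k).
by move=> w v /= ->; rewrite Ff.
Qed.

Fact weak_const n (U : set 'rV[R]_n) (oU : open U) (A : set X) :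
  weak_plot (const_param oU A).
Proof.
move=> r0 /= /eqP/set0P[a Aa].
exists U, oU, (fun x Ux => Ux), (fun=> a); split=> //.
- exact: set_typeP.
- exact: plot_const.
Qed.

Fact weak_local n (P : parametrization R n (set X)) :
  (forall r : pdom P, exists (V : set 'rV[R]_n) (oV : open V)
     (VP : V `<=` pdom P), V (val r) /\ weak_plot (restrict oV VP)) ->
  weak_plot P.
Proof.
move=> h r0 Pr0; have [V [oV [VP [Vr0 wV]]]] := h r0.
have e0 : subfun VP (exist _ (val r0) (mem_set Vr0)) = r0 by exact: val_inj.
have := wV (exist _ (val r0) (mem_set Vr0)); rewrite /= e0.
move=> /(_ Pr0)[W [oW [WV [sigma [Wr0 ps hs]]]]].
exists W, oW, (fun x Wx => VP x (WV x Wx)), sigma; split=> // r.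
have := hs r; rewrite /=.
by congr (P _ _); exact: val_inj.
Qed.

Fact weak_precomp m n (P : parametrization R n (set X))
    (V : set 'rV[R]_m) (oV : open V) (F : V -> pdom P) :
  smooth_between F -> weak_plot P -> weak_plot (precomp oV F).
Proof.
move=> sF wP r0 /= Pr0; have [W [oW [WP [sigma [Wr0 ps hs]]]]] := wP _ Pr0.
have [G sG GF] := preim_lift W sF.
set W' := [set x | _] in G sG GF.
have oW' : open W' by exact: open_preim.
have W'V : W' `<=` V by move=> x [v <- _]; exact: set_typeP.
exists W', oW', W'V, (sigma \o G); split.
- by exists r0.
- exact: (plot_precomp (P := Param oW sigma) oW' sG ps).
- move=> r; have := hs (G r); rewrite /=.
  congr (P _ _); apply: val_inj.
  by rewrite val_subfun; exact: GF.
Qed.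

Definition weak_diffeology : diffeology R (set X) :=
  Diffeology weak_const weak_local weak_precomp.

Fact union_const n (U : set 'rV[R]_n) (oU : open U) (A : set X) :
  union_plot (const_param oU A).
Proof.
exists (option A), (fun o => if o is Some a then const_param oU [set val a]
                             else const_param oU set0).
split.
- case=> [a|]; [right|by left].
  by exists (fun=> val a) => //; exact: plot_const.
- apply/seteqP; split=> x; first by exists None.
  by case=> -[a|].
- move=> r /=; apply/seteqP; split=> x.
    by move=> Ax; exists (Some (exist _ x (mem_set Ax))) => //; exists r.
  by case=> -[a|] _ [s _] //= ->; exact: set_typeP.
Qed.

Fact union_local n (P : parametrization R n (set X)) :
  (forall r : pdom P, exists (V : set 'rV[R]_n) (oV : open V)
     (VP : V `<=` pdom P), V (val r) /\ union_plot (restrict oV VP)) ->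
  union_plot P.
Proof.
move=> h.
have /choice[V hV] := h.
have /choice[J hJ] : forall r : pdom P, exists (J : Type),
    exists (oV : open (V r)) (VP : V r `<=` pdom P)
           (Pi : J -> parametrization R n (set X)),
    V r (val r) /\
    [/\ forall i, empty_or_point_plot (Pi i),
        V r = \bigcup_i pdom (Pi i)
      & forall s : V r, P (subfun VP s) =
          \bigcup_i \bigcup_(t in [set t : pdom (Pi i) | val t = val s])
             Pi i t].
  move=> r; have [oV [VP [Vr [J [Pi hPi]]]]] := hV r.
  by exists J, oV, VP, Pi.
have {}hJ r : {Pi : J r -> parametrization R n (set X) |
    exists (oV : open (V r)) (VP : V r `<=` pdom P),
    V r (val r) /\
    [/\ forall i, empty_or_point_plot (Pi i),
        V r = \bigcup_i pdom (Pi i)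
      & forall s : V r, P (subfun VP s) =
          \bigcup_i \bigcup_(t in [set t : pdom (Pi i) | val t = val s])
             Pi i t]}.
  apply: cid; have [oV [VP [Pi hPi]]] := hJ r.
  by exists Pi, oV, VP.
exists {r : pdom P & J r}, (fun u => sval (hJ (projT1 u)) (projT2 u)); split.
- case=> r j /=; case: (hJ r) => Pi /= [oV [VP [_ [h1 _ _]]]]; exact: h1.
- apply/seteqP; split=> x.
    move=> Px; pose r : pdom P := exist _ x (mem_set Px).
    have [_ [_ [Vr [_ dV _]]]] := svalP (hJ r).
    move: Vr; rewrite [X in X _ -> _]dV => -[j _ xj].
    by exists (existT _ r j).
  case=> -[r j] _ /= xj.
  have [_ [VP [_ [_ dV _]]]] := svalP (hJ r).
  by apply: VP; rewrite dV; exists j.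
- move=> r; apply/seteqP; split=> x.
    have [_ [VP [Vr [_ _ hP]]]] := svalP (hJ r).
    have := hP (exist _ (val r) (mem_set Vr)).
    have -> : subfun VP (exist _ (val r) (mem_set Vr)) = r by exact: val_inj.
    move=> -> [j _ [s /= sr xs]].
    by exists (existT _ r j) => //; exists s.
  case=> -[r' j] _ /= [s sr xs].
  have [_ [VP [_ [_ dV hP]]]] := svalP (hJ r').
  have Vr : V r' (val r).
    by rewrite dV; exists j => //=; rewrite -sr; exact: set_typeP.
  have := hP (exist _ (val r) (mem_set Vr)).
  have -> : subfun VP (exist _ (val r) (mem_set Vr)) = r by exact: val_inj.
  by move=> ->; exists j => //; exists s.
Qed.

Fact union_precomp m n (P : parametrization R n (set X))
    (V : set 'rV[R]_m) (oV : open V) (F : V -> pdom P) :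
  smooth_between F -> union_plot P -> union_plot (precomp oV F).
Proof.
move=> sF [J [Pi [h1 dP hP]]].
pose W i := [set x | exists2 v : V, val v = x & pdom (Pi i) (val (F v))].
have oW i : open (W i) by apply: open_preim => //; exact: pdom_open.
have G i : {G : W i -> pdom (Pi i) | smooth_between G /\
    forall (w : W i) (v : V), val w = val v -> val (G w) = val (F v)}.
  by apply: cid; have [G ? ?] := preim_lift (pdom (Pi i)) sF; exists G.
exists J, (fun i => precomp (oW i) (sval (G i))); split.
- move=> i; case: (h1 i) => [e|[p pp e]]; [left|right].
    by move=> r /=; exact: e.
  exists (p \o sval (G i)) => [|r /=]; last exact: e.
  have [sG _] := svalP (G i).
  exact: (plot_precomp (P := Param (pdom_open (Pi i)) p) (oW i) sG pp).
- apply/seteqP; split=> x /=.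
    move=> Vx; pose v : V := exist _ x (mem_set Vx).
    have := set_typeP (F v); rewrite [X in X _ -> _]dP => -[i _ Fi].
    by exists i => //; exists v.
  by case=> i _ [v <- _]; exact: set_typeP.
- move=> r /=; rewrite hP; apply/seteqP; split=> x [i _ [s /= sr xs]];
      exists i => //.
    have Wr : W i (val r) by exists r => //=; rewrite -sr; exact: set_typeP.
    exists (exist _ (val r) (mem_set Wr)) => //=.
    suff -> : sval (G i) (exist _ (val r) (mem_set Wr)) = s by [].
    by apply: val_inj; apply: etrans (esym sr); exact: (svalP (G i)).2.
  exists (sval (G i) s) => //=.
  by rewrite -[RHS]((svalP (G i)).2 s r sr).
Qed.

Definition union_diffeology : diffeology R (set X) :=
  Diffeology union_const union_local union_precomp.

End Diffeologies.

Definition power_w (R : realType) (X : diffeologicalSpace R) :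
    diffeologicalSpace R :=
  DiffeologicalSpace (weak_diffeology X).

Definition power_u (R : realType) (X : diffeologicalSpace R) :
    diffeologicalSpace R :=
  DiffeologicalSpace (union_diffeology X).

(* Main.v *)
Require Import Defs.
From mathcomp Require Import all_boot all_order all_algebra.
From mathcomp Require Import all_classical all_reals all_analysis.

(* A point of P r0 comes from some branch r |-> {p r} of the union, and p is
   then itself a local selection of P, defined on the domain of the branch. *)
Lemma union_plot_weak (R : realType) (X : diffeologicalSpace R) (n : nat)
    (P : parametrization R n (set X)) :
  union_plot P -> weak_plot P.
Proof.
move=> [J [Pi [Pi_plot domP PE]]] r0 /eqP/set0P[x].
rewrite PE => -[i _ [s /= sr0 xs]].
(* The branch [Pi i] contains [x] over [r0], so it cannot be the empty one. *)
case: (Pi_plot i) => [Pi0|[p p_plot Pip]]; first by move: xs; rewrite Pi0.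
have subP : subset (pdom (Pi i)) (pdom P) by rewrite domP => y; exists i.
exists (pdom (Pi i)), (pdom_open (Pi i)), subP, p; split=> //.
- by rewrite -sr0; exact: set_typeP.
(* The other branches only enlarge [P r], so branch [i] alone gives membership on all of its
   domain. *)
- by move=> r; rewrite PE; exists i => //; exists r => //; rewrite Pip.
Qed.

Theorem corollary3p5 (R : realType) (X : diffeologicalSpace R) :
  smooth (id : power_u X -> power_w X) /\
  finer (union_diffeology X) (weak_diffeology X).
Proof.
(* Both conjuncts reduce to the lemma: [weak_plot] reads only the domain and values of [P], which
   postcomposition with [id] preserves up to conversion. *)
by split=> n P uP; exact: (union_plot_weak _ _ _ P uP).
Qed.
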